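(* Let $p$ be a prime, let $m>n>0$ be integers and let $a\in\mathbb{F}_p^*$. If the polynomial $x^m+ax^n$ permutes the prime field $\mathbb{F}_p$, then $p-1\le (m-1)\cdot\max\bigl(n,\gcd(m-n,p-1)\bigr)$.
   Context: A polynomial $f\in\mathbb{F}_q[x]$ is said to permute $\mathbb{F}_q$ (be a permutation polynomial) if the map $\alpha\mapsto f(\alpha)$ is a bijection $\mathbb{F}_q\to\mathbb{F}_q$. *)

(* Defs.v *)
From mathcomp Require Import all_boot all_algebra.
Set Implicit Arguments.
Unset Strict Implicit.
Unset Printing Implicit Defensive.
Import GRing.Theory.
Local Open Scope ring_scope.

Definition permutation_poly (F : finFieldType) (f : {poly F}) : Prop :=
  bijective (fun x : F => f.[x]).

(* Main.v *)
(** Hermite's argument: if [f] permutes [F_p] then the sum of [f(x)^I] over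
    [F_p] vanishes for [0 < I < p - 1].  In the expansion of
    [(a x^n + x^m)^I] only the exponents [n(I - J) + mJ] divisible by [p - 1]
    contribute, so it suffices to find an [I] for which exactly one [J <= I] has
    this property: its binomial coefficient is prime to [p].

    As [f] is injective, [gcd(m, n)] is prime to [p - 1] and may be divided out.
    With [g = gcd(m - n, p - 1)], [p - 1 = gs] and [m - n = gk], such an [I] is
    [gt], where [t] is the least integer with [nt <= s <= mt] and
    [s = nt mod k].  If the bound fails, [t] exists by [(m - 1)n < p - 1], and
    [mt < (k + 1)s] by minimality and [m <= s]; this excludes every other [J]. *)
Require Import Defs.
From mathcomp Require Import all_boot all_algebra.
From mathcomp Require Import finfield zify.
Set Implicit Arguments.
Unset Strict Implicit.
Unset Printing Implicit Defensive.
Import GRing.Theory.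
Local Open Scope ring_scope.

(** Solving [k * J = s] modulo [n] with [J < n] makes [t = (s - k * J) / n] an integer. Then
    [J <= g * t] amounts to [(n + g * k) * J <= g * s], which follows from [J <= n - 1] and the size
    hypothesis. *)
Lemma linear_combination_exists (g k n s : nat) :
    (0 < n)%N -> coprime n k -> ((n + g * k - 1) * n < g * s)%N ->
  exists t J : nat, (n * t + k * J = s)%N /\ (J <= g * t)%N.
Proof.
move=> n_gt0 co_nk lt_s.
(* [chinese n k s 0] is a multiple of [k] congruent to [s] modulo [n]. *)
pose J := ((chinese n k s 0 %/ k) %% n)%N.
have J_lt : (J < n)%N by rewrite ltn_mod.
have dvd_k : (k %| chinese n k s 0)%N.
  by rewrite /dvdn (chinese_modr co_nk) mod0n.
have kJ : (k * J = s %[mod n])%N.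
  by rewrite modnMmr mulnC divnK // chinese_modl.
have mJ_lt : ((n + g * k) * J < g * s)%N.
  apply: leq_ltn_trans lt_s; rewrite mulnBl mul1n leq_subRL; last by nia.
  have le_nm : (n <= n + g * k)%N by rewrite leq_addr.
  apply: (@leq_trans ((n + g * k) * J.+1)); last by rewrite leq_mul2l J_lt orbT.
  by rewrite mulnS leq_add2r.
have g_gt0 : (0 < g)%N by case: (g) mJ_lt.
have kJ_le : (k * J <= s)%N.
  rewrite -(leq_pmul2l g_gt0) mulnA; apply: leq_trans (ltnW mJ_lt).
  by rewrite leq_mul2r leq_addl orbT.
have n_dvd : (n %| s - k * J)%N by rewrite -eqn_mod_dvd // kJ.
case/dvdnP: n_dvd => t s_eq.
exists t, J; split; first by lia.
rewrite -(leq_pmul2l n_gt0) mulnCA [(n * t)%N]mulnC -s_eq mulnBr.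
by rewrite leq_subRL ?leq_pmul2l // mulnA -mulnDl addnC ltnW.
Qed.

(** For [I = g * t] the divisibility reduces to [s %| n * t + k * J']. As [k] is prime to [s], two
    solutions differ by a multiple of [s], and the size of [t] leaves room for only one. *)
Lemma unique_multiple_exists_factored (g k n s : nat) :
    (0 < g)%N -> (0 < k)%N -> (0 < n)%N -> coprime n k -> coprime k s ->
    ((n + g * k - 1) * n < g * s)%N -> (n + g * k <= s)%N ->
  exists I J : nat, [/\ (0 < I < g * s)%N, (J <= I)%N,
    (g * s %| n * I + g * k * J)%N &
    forall J', (J' <= I)%N -> (g * s %| n * I + g * k * J')%N -> J' = J].
Proof.
move=> g_gt0 k_gt0 n_gt0 co_nk co_ks lt_s le_ms.
pose P t := [&& n * t <= s, s <= (n + g * k) * t & k %| s - n * t]%N.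
have exP : exists t, P t.
  have [t [J [s_eq J_le]]] := linear_combination_exists n_gt0 co_nk lt_s.
  exists t; apply/and3P; split; [lia | nia |].
  by rewrite -s_eq addKn dvdn_mulr.
case: (ex_minnP exP) => t /and3P[le_nt le_mt /dvdnP[J J_eq]] t_min.
have t_gt0 : (0 < t)%N by nia.
have s_eq : (n * t + k * J = s)%N by lia.
have mt_lt : ((n + g * k) * t < k.+1 * s)%N.
  have s_gt0 : (0 < s)%N by lia.
  have mk_le : ((n + g * k) * k <= k * s)%N by rewrite mulnC leq_mul2l le_ms orbT.
  have [lt_tk | le_kt] := ltnP t k.
    rewrite mulSn; apply: (@leq_ltn_trans (k * s)); last by lia.
    by apply: leq_trans mk_le; rewrite leq_mul2l (ltnW lt_tk) orbT.
  have t_eq : t = (k + (t - k))%N by rewrite subnKC.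
  (* If the bound failed, [t - k] would satisfy [P] too: passing to it lowers [(n + g * k) * t] by
     at most [k * s]. *)
  rewrite ltnNge; apply/negP => le_mt'.
  suff /t_min : P (t - k)%N by lia.
  move: (t - k)%N t_eq => u t_eq; rewrite t_eq in s_eq le_mt'.
  apply/and3P; split; [by lia | by lia |].
  by apply/dvdnP; exists (J + n)%N; lia.
(* Here [t < s] comes from [mt_lt] and [k.+1 <= n + g * k]. *)
exists (g * t)%N, J; split; [by nia | by nia | |].
- by rewrite -s_eq; apply/dvdnP; exists 1%N; lia.
move=> J' le_J'.
have -> : (n * (g * t) + g * k * J' = g * (n * t + k * J'))%N by lia.
rewrite dvdn_pmul2l // => s_dvd.
have [lt_JJ' | lt_J'J | //] := ltngtP J J'.
- have : (s %| k * (J' - J))%N.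
    by rewrite mulnBr -(subnDl (n * t)) s_eq dvdn_sub.
  rewrite Gauss_dvdr 1?coprime_sym // => /dvdn_leq s_le.
  (* Adding [n * t] to both sides contradicts [mt_lt]. *)
  have le_J : (k * (J + s) <= k * (g * t))%N by rewrite leq_mul2l; lia.
  by lia.
- have : (s %| k * (J - J'))%N.
    by rewrite mulnBr -(subnDl (n * t)) s_eq dvdn_sub.
  rewrite Gauss_dvdr 1?coprime_sym // => /dvdn_leq s_le.
  (* This is absurd, since [k * J = s - n * t < s]. *)
  have le_s : (k * s <= k * J)%N by rewrite leq_mul2l; lia.
  have := leq_pmull s k_gt0; have : (0 < n * t)%N by rewrite muln_gt0 n_gt0.
  by lia.
Qed.

(** Since [gcdn m n] is prime to [N], dividing [m] and [n] by it preserves both the divisibility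
    condition and [gcdn (m - n) N]; the bound survives because [m] and [n] can only shrink. *)
Lemma unique_multiple_exists (N m n : nat) :
    (0 < N)%N -> (0 < n)%N -> (n < m)%N -> coprime (gcdn m n) N ->
    ((m - 1) * maxn n (gcdn (m - n) N) < N)%N ->
  exists I J : nat, [/\ (0 < I < N)%N, (J <= I)%N,
    (N %| n * (I - J) + m * J)%N &
    forall J', (J' <= I)%N -> (N %| n * (I - J') + m * J')%N -> J' = J].
Proof.
move=> N_gt0 n_gt0 lt_nm co_dN lt_N.
pose d := gcdn m n.
have d_gt0 : (0 < d)%N by rewrite gcdn_gt0 n_gt0 orbT.
have [m' m_eq] := dvdnP (dvdn_gcdl m n : (d %| m)%N).
have [n' n_eq] := dvdnP (dvdn_gcdr m n : (d %| n)%N).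
have co_mn' : coprime m' n'.
  by rewrite /coprime -(eqn_pmul2r d_gt0) muln_gcdl -m_eq -n_eq mul1n.
pose g := gcdn (m' - n') N.
have g_gt0 : (0 < g)%N by rewrite gcdn_gt0 N_gt0 orbT.
have g_eq : gcdn (m - n) N = g.
  by rewrite m_eq n_eq -mulnBl gcdnC Gauss_gcdl 1?gcdnC // coprime_sym.
have [k k_eq] := dvdnP (dvdn_gcdl (m' - n') N : (g %| m' - n')%N).
have [s s_eq] := dvdnP (dvdn_gcdr (m' - n') N : (g %| N)%N).
have lt_nm' : (n' < m')%N by nia.
have m'_eq : (m' = n' + g * k)%N by lia.
have co_ks : coprime k s.
  by rewrite /coprime -(eqn_pmul2r g_gt0) muln_gcdl -k_eq -s_eq mul1n.
have co_nk : coprime n' k.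
  move: co_mn'; rewrite coprime_sym /coprime m'_eq gcdnDl -/(coprime _ _).
  by rewrite coprimeMr => /andP[].
rewrite g_eq in lt_N.
have lt_n : ((m - 1) * n < N)%N.
  by apply: leq_ltn_trans lt_N; rewrite leq_mul2l leq_maxl orbT.
have lt_g : ((m - 1) * g < N)%N.
  by apply: leq_ltn_trans lt_N; rewrite leq_mul2l leq_maxr orbT.
have le_m' : (m' <= m)%N by rewrite m_eq leq_pmulr.
have le_n' : (n' <= n)%N by rewrite n_eq leq_pmulr.
have N_eq : N = (g * s)%N by lia.
have [] := @unique_multiple_exists_factored g k n' s g_gt0 _ _ co_nk co_ks.
- by nia.
- by nia.
- rewrite -m'_eq -N_eq; apply: leq_ltn_trans lt_n.
  by apply: leq_mul => //; lia.
- rewrite -m'_eq; have : (m - 1 < s)%N by rewrite -(ltn_pmul2r g_gt0) -s_eq.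
  by lia.
move=> I [J [I_bounds J_le dvd_J uniq_J]].
have dvdE J' : (J' <= I)%N ->
    (N %| n * (I - J') + m * J')%N = (N %| n' * I + g * k * J')%N.
  move=> le_J'.
  have -> : (n * (I - J') + m * J' = d * (n' * I + g * k * J'))%N.
    by rewrite -[in RHS](subnKC le_J') m_eq n_eq m'_eq; move: (I - J')%N; lia.
  by rewrite Gauss_dvdr // coprime_sym.
rewrite -N_eq in I_bounds dvd_J uniq_J.
exists I, J; split=> //; first by rewrite dvdE.
by move=> J' le_J'; rewrite dvdE //; apply: uniq_J.
Qed.

Section PowerSums.
Variable F : finFieldType.

Lemma expf_card_pred (x : F) : x != 0 -> x ^+ (#|F| - 1) = 1.
Proof.
move=> x_neq0; apply: (mulfI x_neq0).
by rewrite mulr1 -exprS subn1 prednK ?expf_card // ltnW ?finNzRing_gt1.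
Qed.

(** Otherwise all [#|F| - 1] nonzero elements would be roots of unity of the smaller positive order
    [k %% (#|F| - 1)]. *)
Lemma exists_expf_neq1 (k : nat) : ~~ (#|F| - 1 %| k)%N ->
  exists2 c : F, c != 0 & c ^+ k != 1.
Proof.
move=> ndvd; pose N := (#|F| - 1)%N.
have N_gt0 : (0 < N)%N by rewrite subn_gt0 finNzRing_gt1.
have r_gt0 : (0 < k %% N)%N by rewrite lt0n.
have [/existsP[c /andP[c0 ck]] | none] :=
  boolP [exists c : F, (c != 0) && (c ^+ k != 1)]; first by exists c.
have root_all : all (k %% N).-unity_root (enum (predC1 (0 : F))).
  apply/allP => c; rewrite mem_enum inE unity_rootE => c_neq0.
  move/existsPn/(_ c): none; rewrite c_neq0 negbK {1}(divn_eq k N) exprD mulnC.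
  by rewrite exprM expf_card_pred // expr1n mul1r.
have := max_unity_roots r_gt0 root_all (enum_uniq _).
by rewrite -cardE cardC1 -subn1 leqNgt ltn_mod N_gt0.
Qed.

(** Scaling the variable by [c] preserves the sum, yet multiplies it by [c ^+ k != 1]. *)
Lemma power_sum_eq0 (k : nat) :
  ~~ (#|F| - 1 %| k)%N -> \sum_(x : F) x ^+ k = 0.
Proof.
case/exists_expf_neq1 => c c_neq0 ck_neq1.
have : \sum_(x : F) x ^+ k = c ^+ k * \sum_(x : F) x ^+ k.
  rewrite [LHS](reindex_inj (mulfI c_neq0)) mulr_sumr.
  by apply: eq_bigr => x _; rewrite exprMn.
move/eqP; rewrite -subr_eq0 -{1}[\sum_x _]mul1r -mulrBl mulf_eq0 subr_eq0.
by rewrite eq_sym (negPf ck_neq1) => /eqP.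
Qed.

Lemma power_sum_eqN1 (k : nat) :
  (0 < k)%N -> (#|F| - 1 %| k)%N -> \sum_(x : F) x ^+ k = -1.
Proof.
move=> k_gt0 /dvdnP[e k_eq].
(* The translation by 1 permutes [F], so it preserves the sum of all elements. *)
have sum_const : \sum_(x : F) (1 : F) = 0.
  apply: (addrI (\sum_(x : F) x)); rewrite addr0 -big_split.
  by rewrite [RHS](reindex_inj (addIr 1)).
apply/eqP; rewrite -addr_eq0; apply/eqP; rewrite -[RHS]sum_const.
rewrite (bigD1 0) //= [RHS](bigD1 0) //=.
rewrite expr0n gtn_eqF // add0r addrC; congr (_ + _).
apply: eq_bigr => x x_neq0.
by rewrite k_eq mulnC exprM expf_card_pred // expr1n.
Qed.

End PowerSums.

Lemma prime_ndvd_bin (p I J : nat) :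
  prime p -> (I < p)%N -> (J <= I)%N -> ~~ (p %| 'C(I, J))%N.
Proof.
move=> p_prime lt_Ip le_JI; apply/negP => p_dvd.
have : (p %| I`!)%N by rewrite -(bin_fact le_JI) dvdn_mulr.
elim: I lt_Ip {le_JI p_dvd} => [|I IHI] lt_Ip.
  by rewrite fact0 dvdn1 => /eqP p1; rewrite p1 in p_prime.
rewrite factS Euclid_dvdM // gtnNdvd //=.
by apply: IHI; apply: ltnW.
Qed.

Lemma binomial_horner (R : comNzRingType) (a x : R) (m n : nat) :
  ('X^m + a *: 'X^n).[x] = a * x ^+ n + x ^+ m.
Proof. by rewrite !hornerE addrC. Qed.

Lemma binomial_horner_exp (R : comNzRingType) (a x : R) (m n I : nat) :
  ('X^m + a *: 'X^n).[x] ^+ I =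
  \sum_(J < I.+1)
    (a ^+ (I - J) *+ 'C(I, J)) * x ^+ (n * (I - J) + m * J).
Proof.
rewrite binomial_horner exprDn; apply: eq_bigr => J _.
by rewrite exprMn -!exprM -mulrA -exprD mulrnAl.
Qed.

(** The binomial factors through [x ^+ e], with [e] the gcd in question, so this power map is a
    bijection. If [e > 1], reindexing by it equates the sum of [x ^+ u], [u = (#|F| - 1) / e], which
    is 0, with that of [x ^+ (#|F| - 1)], which is -1. *)
Lemma permutation_binomial_coprime (F : finFieldType) (m n : nat) (a : F) :
    (0 < n)%N -> (0 < m)%N -> permutation_poly ('X^m + a *: 'X^n) ->
  coprime (gcdn m n) (#|F| - 1).
Proof.
move=> n_gt0 m_gt0 /bij_inj f_inj.
have F_gt1 := finNzRing_gt1 F.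
pose e := gcdn (gcdn m n) (#|F| - 1).
have e_gt0 : (0 < e)%N by rewrite !gcdn_gt0 n_gt0 orbT.
have [e_dvd_m e_dvd_n] : (e %| m)%N /\ (e %| n)%N.
  by split; apply: dvdn_trans (dvdn_gcdl _ _) _; rewrite (dvdn_gcdl, dvdn_gcdr).
have [m' m_eq] := dvdnP e_dvd_m; have [n' n_eq] := dvdnP e_dvd_n.
have [u u_eq] := dvdnP (dvdn_gcdr (gcdn m n) (#|F| - 1) : e %| _)%N.
have pow_inj : injective (fun x : F => x ^+ e).
  move=> x y /= eq_xy; apply: f_inj; rewrite !binomial_horner.
  by rewrite m_eq n_eq ![(_ * e)%N]mulnC !exprM eq_xy.
have N_gt0 : (0 < #|F| - 1)%N by rewrite subn_gt0.
have u_gt0 : (0 < u)%N by move: N_gt0; rewrite u_eq muln_gt0 => /andP[].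
rewrite /coprime -/e; apply/eqP; case: (ltngtP e 1) => // [|e_gt1]; first by lia.
have u_ndvd : ~~ (#|F| - 1 %| u)%N by rewrite gtnNdvd // u_eq ltn_Pmulr.
have := power_sum_eq0 u_ndvd; rewrite (reindex_inj pow_inj) /=.
under eq_bigr do rewrite -exprM mulnC -u_eq.
rewrite power_sum_eqN1 ?dvdnn // => /eqP.
by rewrite oppr_eq0 oner_eq0.
Qed.

Theorem theorem1p2 (p m n : nat) (a : 'F_p)
    (p_prime : prime p) (n_gt0 : (0 < n)%N) (n_lt_m : (n < m)%N)
    (a_neq0 : a != 0)
    (f_perm : permutation_poly ('X^m + a *: 'X^n)) :
  (p - 1 <= (m - 1) * maxn n (gcdn (m - n) (p - 1)))%N.
Proof.
have p_gt1 := prime_gt1 p_prime.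
have co_d : coprime (gcdn m n) (p - 1).
  rewrite -(card_Fp p_prime); apply: permutation_binomial_coprime f_perm => //.
  exact: leq_ltn_trans n_lt_m.
rewrite leqNgt; apply/negP => bound_fails.
have p1_gt0 : (0 < p - 1)%N by rewrite subn_gt0.
have [I [J [/andP[I_gt0 I_lt] J_le J_dvd J_uniq]]] :=
  unique_multiple_exists p1_gt0 n_gt0 n_lt_m co_d bound_fails.
have I_ndvd : ~~ (#|'F_p| - 1 %| I)%N by rewrite card_Fp // gtnNdvd.
have := power_sum_eq0 I_ndvd; rewrite (reindex_inj (bij_inj f_perm)) /=.
under eq_bigr do rewrite binomial_horner_exp.
rewrite exchange_big /=; under eq_bigr do rewrite -mulr_sumr.
rewrite (bigD1 (Ordinal (J_le : J < I.+1)%N)) //= [X in _ + X]big1 => [|J' neq_J'].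
  (* The exponent is positive because [I > 0]; the surviving term is minus
     [a ^+ (I - J) *+ 'C(I, J)], a nonzero element. *)
  rewrite addr0 power_sum_eqN1 ?card_Fp //; last by nia.
  move/eqP; rewrite mulf_eq0 oppr_eq0 oner_eq0 orbF -mulr_natr mulf_eq0.
  rewrite expf_eq0 (negPf a_neq0) andbF -(dvdn_pcharf (pchar_Fp p_prime)) /=.
  by apply/negP/prime_ndvd_bin => //; lia.
rewrite power_sum_eq0 ?mulr0 // card_Fp //.
apply: contra neq_J' => dvd_J'; apply/eqP/val_inj/J_uniq => //=.
by rewrite -ltnS.
Qed.
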